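(* $\mathsf{FS}^{!\omega} \leq_{\mathrm{sW}} \mathsf{RT}^{!\omega}_2$.
   Context: For $X \subseteq \mathbb{N}$, $[X]^{!\omega}$ is the set of finite $s \subseteq X$ with $|s| = 1+\min s$. $\mathsf{FS}^{!\omega}$ is the problem whose instances are colorings $f : [\mathbb{N}]^{!\omega} \to \mathbb{N}$ and whose solutions for $f$ are infinite sets $H \subseteq \mathbb{N}$ such that for every $s \in [H]^{!\omega}$, $f(s) \notin H \setminus s$. $\mathsf{RT}^{!\omega}_2$ is the problem whose instances are colorings $f : [\mathbb{N}]^{!\omega} \to \{0,1\}$ and whose solutions are infinite $H \subseteq \mathbb{N}$ with $|f([H]^{!\omega})| = 1$. A problem $\mathsf{Q}$ is strongly Weihrauch reducible to $\mathsf{P}$ ($\mathsf{Q} \leq_{\mathrm{sW}} \mathsf{P}$) if there are Turing functionals $\Phi, \Psi$ such that for every instance $X$ of $\mathsf{Q}$, $\Phi(X)$ is an instance of $\mathsf{P}$, and for every solution $Y$ to $\mathsf{P}$ for $\Phi(X)$, $\Psi(Y)$ is a solution to $\mathsf{Q}$ for $X$. *)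

(* Defs.v *)
From mathcomp Require Import all_boot finmap.
From mathcomp Require Import boolp classical_sets cardinality.

Set Implicit Arguments.
Unset Strict Implicit.
Unset Printing Implicit Defensive.

Local Open Scope classical_set_scope.

(* Turing functionals are given by indices of partial recursive functions
   relative to an oracle X : nat -> nat (Kleene's schemes on tuples, with
   [Oracle] denoting X). A primitive recursion recurses on its first argument
   and passes the step function the counter, then the previous value. *)
Inductive code : Type :=
  | Zero
  | Succ
  | Proj of nat
  | Oracle
  | Comp of code & seq code
  | Prec of code & code
  | Mu of code.

(* [eval X e v r]: the e-th partial function, with oracle X, halts on the
   tuple v with value r. *)
Inductive eval (X : nat -> nat) : code -> seq nat -> nat -> Prop :=
  | eval_zero v : eval X Zero v 0
  | eval_succ x v : eval X Succ (x :: v) x.+1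
  | eval_proj i v : i < size v -> eval X (Proj i) v (nth 0 v i)
  | eval_oracle x v : eval X Oracle (x :: v) (X x)
  | eval_comp f gs v w r :
      size w = size gs ->
      (forall i, i < size gs -> eval X (nth Zero gs i) v (nth 0 w i)) ->
      eval X f w r ->
      eval X (Comp f gs) v r
  | eval_prec0 f g v r :
      eval X f v r -> eval X (Prec f g) (0 :: v) r
  | eval_precS f g n v y r :
      eval X (Prec f g) (n :: v) y ->
      eval X g [:: n, y & v] r ->
      eval X (Prec f g) (n.+1 :: v) r
  | eval_mu f v n (h : nat -> nat) :
      (forall i, i < n -> eval X f (i :: v) (h i).+1) ->
      eval X f (n :: v) 0 ->
      eval X (Mu f) v n.

Lemma eval_det X e v r r' : eval X e v r -> eval X e v r' -> r = r'.
Proof.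
move=> H; elim: H r' => {e v r}.
- by move=> v r' H; inversion H.
- by move=> x v r' H; inversion H.
- by move=> i v _ r' H; inversion H.
- by move=> x v r' H; inversion H.
- move=> f gs v w r sw _ IHg _ IHf r' H.
  inversion H as [| | | |? ? ? w' ? sw' Hg Hf| | |]; subst.
  apply: IHf; suff -> : w = w' by [].
  apply: (@eq_from_nth _ 0); first by rewrite sw.
  by move=> i; rewrite sw => ig; apply: IHg => //; apply: Hg.
- by move=> f g v r _ IH r' H; inversion H; subst; apply: IH.
- move=> f g n v y r _ IH1 _ IH2 r' H.
  inversion H as [| | | | | |? ? ? ? y' ? Hy Hr|]; subst.
  by apply: IH2; rewrite (IH1 _ Hy).
- move=> f v n h _ IH1 _ IH2 r' H.
  inversion H as [| | | | | | |? ? ? h' Hlt H0]; subst.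
  case: (ltngtP n r') => // lt.
  + by have := IH2 _ (Hlt _ lt).
  + by have := IH1 _ lt _ H0.
Qed.

(* The functional with index e is defined on X, with (total) value Y. *)
Definition computes (e : code) (X Y : nat -> nat) : Prop :=
  forall n, eval X e [:: n] (Y n).

(* Instances and solutions are presented to functionals through their
   representations as elements of Baire space. *)
Record problem := Problem {
  instance : Type;
  solution : Type;
  instance_rep : instance -> nat -> nat;
  solution_rep : solution -> nat -> nat;
  solves : instance -> solution -> Prop }.

Definition sW_reducible (Q P : problem) : Prop :=
  exists Phi Psi : code,
    forall x : instance Q,
      exists2 p : instance P,
        computes Phi (instance_rep x) (instance_rep p) &
        forall y : solution P, solves p y ->
          exists2 z : solution Q,
            computes Psi (solution_rep y) (solution_rep z) & solves x z.

Notation "Q <=sW P" := (sW_reducible Q P) (at level 70, no associativity).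

(* Some m in s is its minimum and |s| = 1 + m; in particular s is nonempty. *)
Definition exactly_large (s : {fset nat}) : bool :=
  has (fun m => all (leq m) s && (#|` s| == 1 + m)) s.

Definition large_set : Type := {s : {fset nat} | exactly_large s}.

(* [X]^{!omega} *)
Definition large_subsets (X : set nat) : set large_set :=
  [set s | [set` val s] `<=` X].

(* The n-th finite set in the canonical (binary) indexing, which is a bijection
   between nat and {fset nat}: see [canonical_setK] and [canonical_indexK]. *)
Definition canonical_set (n : nat) : {fset nat} :=
  [fset i in iota 0 n | odd (n %/ 2 ^ i)]%fset.

Definition canonical_index (s : {fset nat}) : nat := \sum_(i <- s) 2 ^ i.

Lemma in_canonical_set n i : (i \in canonical_set n) = odd (n %/ 2 ^ i).
Proof.
rewrite /canonical_set !inE /= mem_iota add0n /=.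
case: ltnP => //= ni.
by rewrite divn_small //; apply: leq_ltn_trans ni _; apply: ltn_expl.
Qed.

Lemma canonical_set_inj : injective canonical_set.
Proof.
move=> m n /fsetP E.
have {}E i : odd (m %/ 2 ^ i) = odd (n %/ 2 ^ i).
  by have := E i; rewrite !in_canonical_set.
elim/ltn_ind: m n E => m IH n E.
have E0 := E 0; rewrite expn0 !divn1 in E0.
have half k i : (k./2 %/ 2 ^ i) = k %/ 2 ^ i.+1 by rewrite -divn2 -divnMA -expnS.
case: m IH E E0 => [|m] IH E E0.
  move: E {E0}; elim/ltn_ind: n {IH} => n IH E.
  case: n IH E => // n IH E.
  have h0 : 0 = n.+1./2.
    apply: IH; first by rewrite -divn2 ltn_Pdiv.
    by move=> i; rewrite half -E !div0n.
  by have := E 0; rewrite expn0 !divn1 -[in RHS](odd_double_half n.+1) -h0 addn0;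
    have := odd_double_half n.+1; rewrite -h0 addn0 /=; case: (odd n).
rewrite -(odd_double_half m.+1) -(odd_double_half n) E0; congr (_ + _.*2).
apply: IH => [|i]; first by rewrite -divn2 ltn_Pdiv.
by rewrite !half.
Qed.

Lemma canonical_indexK : cancel canonical_index canonical_set.
Proof.
move=> s; apply/fsetP => i; rewrite in_canonical_set /canonical_index.
rewrite (bigID (fun j => j < i)) /=.
have lt : \sum_(j <- s | j < i) 2 ^ j < 2 ^ i.
  apply: (@leq_ltn_trans (\sum_(0 <= j < i) 2 ^ j)); last first.
    elim: i => [|i IH]; first by rewrite big_geq.
    by rewrite big_nat_recr //= expnS mul2n -addnn ltn_add2r.
  rewrite -big_filter.
  have us : uniq [seq j <- s | j < i] by rewrite filter_uniq ?fset_uniq.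
  rewrite [leqRHS](bigID (mem s)) /= -[leqLHS]addn0 leq_add //.
  rewrite -[leqRHS]big_filter eq_leq //; apply: perm_big; apply: uniq_perm => //.
    by rewrite filter_uniq ?iota_uniq.
  by move=> j; rewrite !mem_filter mem_index_iota /= andbC.
have -> : \sum_(j <- s | ~~ (j < i)) 2 ^ j
        = (\sum_(j <- s | ~~ (j < i)) 2 ^ (j - i)) * 2 ^ i.
  rewrite big_distrl /=; apply: eq_bigr => j; rewrite -leqNgt => ij.
  by rewrite -expnD subnK.
rewrite divnDMl ?expn_gt0 // divn_small // add0n.
rewrite big_mkcond /= (big_morph odd oddD (erefl : odd 0 = false)).
case: (boolP (i \in s)) => si.
  rewrite (big_rem _ si) /= ltnn subnn /= big1_seq // => j /=.
  rewrite mem_rem_uniq ?fset_uniq // !inE => /andP[ji _].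
  case: ltnP => //= ij; rewrite oddX subn_eq0.
  by rewrite orbF leqNgt ltn_neqAle eq_sym ji ij.
rewrite big1_seq // => j /= sj.
case: ltnP => //= ij; rewrite oddX subn_eq0 orbF leqNgt ltn_neqAle ij andbT.
by apply/negbTE; rewrite negbK; apply: contraNneq si => ->.
Qed.

Lemma canonical_setK : cancel canonical_set canonical_index.
Proof. by move=> n; apply: canonical_set_inj; rewrite canonical_indexK. Qed.

(* The value at n is the color of the n-th finite set if that set lies in
   [nat]^{!omega}, and 0 otherwise. *)
Definition coloring_rep (f : large_set -> nat) (n : nat) : nat :=
  if insub (canonical_set n) is Some s then f s else 0.

Definition set_rep (H : set nat) (n : nat) : nat := n \in H.

Definition FS_large : problem :=
  @Problem (large_set -> nat) (set nat) coloring_rep set_rep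
    (fun f H => infinite_set H /\
      forall s, large_subsets H s -> ~ (H `\` [set` val s]) (f s)).

Definition RT2_large : problem :=
  @Problem (large_set -> 'I_2) (set nat)
    (fun f => coloring_rep (fun s => f s)) set_rep
    (fun f H => infinite_set H /\
      exists c, f @` large_subsets H = [set c]).

(* Main.v *)
From mathcomp Require Import all_boot finmap.
From mathcomp Require Import boolp classical_sets cardinality.
Require Import Defs.

Set Implicit Arguments.
Unset Strict Implicit.
Unset Printing Implicit Defensive.

(** Call the large initial segment of a set the member of [[nat]^{!omega}] that
    it extends.  For t in [[nat]^{!omega}] with maximum w and min t > 0, the set
    s = (t \ {w}) - 1 is again in [[nat]^{!omega}].  Let z = f(s) + 1 and let t'
    be the large initial segment of t U {z}.  When z < w and z is not in t, the
    binary index of t' is smaller than that of t, so the chain t, t', t'', ...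
    stops; color t by the parity of its length.  Given Y homogeneous for this
    coloring, H = {n | n + 1 in Y} is free for f: if s is a large subset of H
    with f(s) in H \ s, pick w in Y above s + 1 and f(s) + 1; then
    t = (s + 1) U {w} and t' are both large subsets of Y, and their colors
    differ. *)

(** * Oracle computability *)

(* Uniformly in the oracle; only totality on tuples of length [k] is asked. *)
Definition computable (k : nat) (F : (nat -> nat) -> seq nat -> nat) : Prop :=
  exists e, forall X v, size v = k -> eval X e v (F X v).

Lemma computable_ext k F G :
  (forall X v, size v = k -> F X v = G X v) -> computable k F -> computable k G.
Proof. by move=> FG [e He]; exists e => X v sv; rewrite -FG //; apply: He. Qed.

Lemma computable_proj k i : i < k -> computable k (fun _ v => nth 0 v i).
Proof. by move=> ik; exists (Proj i) => X v sv; apply: eval_proj; rewrite sv. Qed.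

(** [Comp] needs one code per argument function, chosen independently of oracle and tuple; induction
    on the list gathers the separate existence statements into a single sequence of codes. *)
Lemma computable_comp k (Fs : seq ((nat -> nat) -> seq nat -> nat)) G :
  (forall i, i < size Fs -> computable k (nth (fun _ _ => 0) Fs i)) ->
  computable (size Fs) G ->
  computable k (fun X v => G X [seq F X v | F <- Fs]).
Proof.
move=> HFs [e He].
have [es ses Hes] : exists2 es, size es = size Fs &
    forall i, i < size Fs -> forall X v, size v = k ->
      eval X (nth Zero es i) v (nth (fun _ _ => 0) Fs i X v).
  elim: Fs HFs {G e He} => [|F Fs IH] HFs; first by exists [::].
  have [es ses Hes] := IH (fun i => HFs i.+1).
  have [e He] := HFs 0 isT.
  by exists (e :: es) => /= [|[|i] //]; [rewrite ses|apply: Hes].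
exists (Comp e es) => X v sv.
apply: (eval_comp (w := [seq F X v | F <- Fs])); first by rewrite size_map ses.
- move=> i; rewrite ses => iFs.
  by rewrite (nth_map (fun _ _ => 0)) //; apply: Hes.
- by apply: He; rewrite size_map.
Qed.

Lemma computable_comp1 k G F :
  computable 1 G -> computable k F -> computable k (fun X v => G X [:: F X v]).
Proof. by move=> HG HF; apply: (@computable_comp k [:: F] G) => // -[]. Qed.

Lemma computable_comp2 k G F1 F2 :
  computable 2 G -> computable k F1 -> computable k F2 ->
  computable k (fun X v => G X [:: F1 X v; F2 X v]).
Proof.
by move=> HG H1 H2; apply: (@computable_comp k [:: F1; F2] G) => // -[|[]].
Qed.

Lemma computable_comp3 k G F1 F2 F3 :
  computable 3 G -> computable k F1 -> computable k F2 -> computable k F3 ->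
  computable k (fun X v => G X [:: F1 X v; F2 X v; F3 X v]).
Proof.
move=> HG H1 H2 H3.
by apply: (@computable_comp k [:: F1; F2; F3] G) => // -[|[|[]]].
Qed.

Lemma computable_succ k F :
  computable k F -> computable k (fun X v => (F X v).+1).
Proof.
apply: (@computable_comp1 k (fun _ v => (nth 0 v 0).+1)).
by exists Succ => X [//|x v] _; apply: eval_succ.
Qed.

Lemma computable_oracle k F :
  computable k F -> computable k (fun X v => X (F X v)).
Proof.
apply: (@computable_comp1 k (fun X v => X (nth 0 v 0))).
by exists Oracle => X [//|x v] _; apply: eval_oracle.
Qed.

Lemma computable_const k c : computable k (fun _ _ => c).
Proof.
elim: c => [|c]; last exact: computable_succ.
by exists Zero => X v _; apply: eval_zero.
Qed.

Lemma computable_rec k F G :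
  computable k F -> computable k.+2 G ->
  computable k.+1 (fun X v =>
    nat_rect (fun=> nat) (F X (behead v)) (fun n y => G X [:: n, y & behead v]) (head 0 v)).
Proof.
move=> [e He] [g Hg]; exists (Prec e g) => X [//|n v] /= [sv].
elim: n => [|n IH] /=; first by apply: eval_prec0; apply: He.
by apply: eval_precS IH _; apply: Hg; rewrite /= sv.
Qed.

Lemma computable_rec1 G c :
  computable 2 (fun X v => G X (nth 0 v 0) (nth 0 v 1)) ->
  computable 1 (fun X v => nat_rect (fun=> nat) c (G X) (nth 0 v 0)).
Proof.
move=> HG; apply: computable_ext (computable_rec (computable_const 0 c) HG).
by move=> X [|n []].
Qed.

(** Recursion with one parameter. The positions 2, 0, 1 reflect that [Prec] hands the step function
    the counter, then the previous value, then the parameter. *)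
Lemma computable_rec2 F G :
  computable 1 (fun X v => F X (nth 0 v 0)) ->
  computable 3 (fun X v => G X (nth 0 v 2) (nth 0 v 0) (nth 0 v 1)) ->
  computable 2 (fun X v =>
    nat_rect (fun=> nat) (F X (nth 0 v 1)) (G X (nth 0 v 1)) (nth 0 v 0)).
Proof.
move=> HF HG; apply: computable_ext (computable_rec HF HG).
by move=> X [|n [|m []]].
Qed.

(** * Arithmetic, comparisons and definition by cases *)

Lemma computable_pred k F :
  computable k F -> computable k (fun X v => (F X v).-1).
Proof.
apply: (@computable_comp1 k (fun _ v => (nth 0 v 0).-1)).
apply: computable_ext (computable_rec1 0 (G := fun _ n _ => n) _).
  by move=> X v _; case: (nth 0 v 0).
exact: computable_proj.
Qed.

Lemma computable_add k F G :
  computable k F -> computable k G -> computable k (fun X v => F X v + G X v).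
Proof.
apply: (@computable_comp2 k (fun _ v => nth 0 v 0 + nth 0 v 1)).
apply: computable_ext (computable_rec2
  (F := fun _ n => n) (G := fun _ _ _ y => y.+1) _ _).
- by move=> X v _; elim: (nth 0 v 0) => //= n ->.
- exact: computable_proj.
- exact/computable_succ/computable_proj.
Qed.

Lemma computable_sub k F G :
  computable k F -> computable k G -> computable k (fun X v => F X v - G X v).
Proof.
move=> HF HG.
(* The arguments are swapped so that the recursion runs on the subtrahend. *)
apply: (@computable_comp2 k (fun _ v => nth 0 v 1 - nth 0 v 0)) HG HF.
apply: computable_ext (computable_rec2
  (F := fun _ n => n) (G := fun _ _ _ y => y.-1) _ _).
- by move=> X v _; elim: (nth 0 v 0) => [|n /= ->]; rewrite ?subn0 ?subnS.
- exact: computable_proj.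
- exact/computable_pred/computable_proj.
Qed.

Lemma computable_leq k F G :
  computable k F -> computable k G ->
  computable k (fun X v => F X v <= G X v : nat).
Proof.
move=> HF HG; apply: computable_ext
  (computable_sub (computable_const k 1) (computable_sub HF HG)).
by move=> X v _; rewrite -subn_eq0; case: (F X v - G X v) => [|[]].
Qed.

Lemma computable_eq k F G :
  computable k F -> computable k G ->
  computable k (fun X v => F X v == G X v : nat).
Proof.
move=> HF HG; apply: computable_ext (computable_leq
  (computable_add (computable_sub HF HG) (computable_sub HG HF))
  (computable_const k 0)).
by move=> X v _; rewrite leqn0 addn_eq0 !subn_eq0 -eqn_leq.
Qed.

(** Branching is a primitive recursion on the truth value: the base value is the else branch, and
    the step ignores its inputs and returns the then branch. *)
Lemma computable_if k (C : (nat -> nat) -> seq nat -> bool) F G :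
  computable k (fun X v => C X v : nat) -> computable k F -> computable k G ->
  computable k (fun X v => if C X v then F X v else G X v).
Proof.
move=> HC HF HG.
have H : computable 3 (fun _ v =>
    nat_rect (fun=> nat) (nth 0 v 2) (fun _ _ => nth 0 v 1) (nth 0 v 0)).
  apply: computable_ext (@computable_rec 2
    (fun _ v => nth 0 v 1) (fun _ v => nth 0 v 2) _ _).
  - by move=> X [|c [|a [|b []]]].
  - exact: computable_proj.
  - exact: computable_proj.
apply: computable_ext (computable_comp3 H HC HF HG).
by move=> X v _ /=; case: (C X v).
Qed.

Lemma computable_minn k F G :
  computable k F -> computable k G ->
  computable k (fun X v => minn (F X v) (G X v)).
Proof.
move=> HF HG; rewrite /minn.
by apply: computable_if => //; apply: computable_leq => //; apply: computable_succ.
Qed.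

Lemma computable_iter (S : (nat -> nat) -> nat -> nat) k F G :
  computable 1 (fun X v => S X (nth 0 v 0)) ->
  computable k F -> computable k G ->
  computable k (fun X v => iter (F X v) (S X) (G X v)).
Proof.
move=> HS; apply: (@computable_comp2 k
  (fun X v => iter (nth 0 v 0) (S X) (nth 0 v 1))).
apply: computable_ext (computable_rec2
  (F := fun _ n => n) (G := fun X _ _ y => S X y) _ _).
- by move=> X v _; elim: (nth 0 v 0) => //= n ->.
- exact: computable_proj.
- apply: (@computable_comp1 3 (fun X v => S X (nth 0 v 0))) => //.
  exact: computable_proj.
Qed.

Lemma computable_sum (S : (nat -> nat) -> nat -> nat -> nat) k F G :
  computable 2 (fun X v => S X (nth 0 v 0) (nth 0 v 1)) ->
  computable k F -> computable k G ->
  computable k (fun X v => \sum_(i < F X v) S X i (G X v)).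
Proof.
move=> HS; apply: (@computable_comp2 k
  (fun X v => \sum_(i < nth 0 v 0) S X i (nth 0 v 1))).
apply: computable_ext (computable_rec2
  (F := fun _ _ => 0) (G := fun X n i y => y + S X i n) _ _).
- move=> X v _; elim: (nth 0 v 0) => [|n /= ->]; first by rewrite big_ord0.
  by rewrite big_ord_recr.
- exact: computable_const.
- apply: computable_add; first exact: computable_proj.
  by apply: (@computable_comp2 3 (fun X v => S X (nth 0 v 0) (nth 0 v 1))) => //;
    apply: computable_proj.
Qed.

Lemma computable_half k F :
  computable k F -> computable k (fun X v => (F X v)./2).
Proof.
apply: (@computable_comp1 k (fun _ v => (nth 0 v 0)./2)).
(* The recursion rests on [n.+1./2 = n - n./2]. *)
apply: computable_ext (computable_rec1 0 (G := fun _ n y => n - y) _).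
  move=> X v _; elim: (nth 0 v 0) => //= n ->.
  by rewrite uphalf_half -{1}(odd_double_half n) -addnn addnA addnK.
by apply: computable_sub; apply: computable_proj.
Qed.

Lemma computable_odd k F :
  computable k F -> computable k (fun X v => odd (F X v) : nat).
Proof.
apply: (@computable_comp1 k (fun _ v => odd (nth 0 v 0) : nat)).
apply: computable_ext (computable_rec1 0 (G := fun _ n y => 1 - y) _).
  by move=> X v _; elim: (nth 0 v 0) => //= n ->; case: odd.
by apply: computable_sub; [apply: computable_const|apply: computable_proj].
Qed.

Lemma computable_mul_exp2 k F G :
  computable k F -> computable k G ->
  computable k (fun X v => F X v * 2 ^ G X v).
Proof.
move=> HF HG; apply: computable_ext
  (computable_iter (S := fun _ n => n + n) _ HG HF).
  move=> X v _; elim: (G X v) => [|n /= ->]; first by rewrite muln1.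
  by rewrite addnn -mul2n mulnCA expnS.
by apply: computable_add; apply: computable_proj.
Qed.

Lemma computable_exp2 k F :
  computable k F -> computable k (fun X v => 2 ^ F X v).
Proof.
move=> HF; apply: computable_ext (computable_mul_exp2 (computable_const k 1) HF).
by move=> X v _; rewrite mul1n.
Qed.

Lemma computable_div_exp2 k F G :
  computable k F -> computable k G ->
  computable k (fun X v => F X v %/ 2 ^ G X v).
Proof.
move=> HF HG; apply: computable_ext
  (computable_iter (S := fun _ n => n./2) _ HG HF).
  move=> X v _; elim: (G X v) => [|n /= ->]; first by rewrite divn1.
  by rewrite -divn2 -divnMA expnSr.
exact/computable_half/computable_proj.
Qed.

Lemma computable_mod_exp2 k F G :
  computable k F -> computable k G ->
  computable k (fun X v => F X v %% 2 ^ G X v).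
Proof.
move=> HF HG; apply: computable_ext (computable_sub HF
  (computable_mul_exp2 (computable_div_exp2 HF HG) HG)).
by move=> X v _; rewrite {1}(divn_eq (F X v) (2 ^ G X v)) addnC addnK.
Qed.

(** A recursion equation for the logarithm, which makes it primitive recursive and lets a code find
    the maximum of a finite set from its index. *)
Lemma trunc_log2_succ n :
  trunc_log 2 n.+1 =
  if 2 ^ (trunc_log 2 n).+1 <= n.+1 then (trunc_log 2 n).+1 else trunc_log 2 n.
Proof.
case: n => [|n] //.
have /andP[lo hi] := trunc_log_bounds (isT : 1 < 2) (isT : 0 < n.+1).
case: ifP => H; apply: trunc_log_eq => //.
  by rewrite H (leq_ltn_trans hi) // ltn_exp2l.
by rewrite leqW //= ltnNge H.
Qed.

Lemma computable_trunc_log2 k F :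
  computable k F -> computable k (fun X v => trunc_log 2 (F X v)).
Proof.
apply: (@computable_comp1 k (fun _ v => trunc_log 2 (nth 0 v 0))).
apply: computable_ext (computable_rec1 0
  (G := fun _ n y => if 2 ^ y.+1 <= n.+1 then y.+1 else y) _).
  by move=> X v _; elim: (nth 0 v 0) => // n; rewrite trunc_log2_succ => <-.
have H i : i < 2 -> computable 2 (fun _ v => nth 0 v i) by apply: computable_proj.
apply: computable_if; last exact: H.
- apply: computable_leq; last exact/computable_succ/H.
  exact/computable_exp2/computable_succ/H.
- exact/computable_succ/H.
Qed.

(** * Large initial segments *)

(** Reduction modulo [2 ^ k] erases the binary digits from position [k] on, so initial segments of a
    set become remainders of its index. *)
Lemma in_canonical_set_mod n k i :
  (i \in canonical_set (n %% 2 ^ k)) = (i < k) && (i \in canonical_set n).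
Proof.
rewrite !in_canonical_set; case: ltnP => ik /=.
  (* The erased digits contribute a multiple of [2 ^ (k - i)] to the quotient; it is even because
     [i < k], so the parity is unchanged. *)
  have -> : n %/ 2 ^ i = (n %/ 2 ^ k * 2 ^ (k - i) * 2 ^ i + n %% 2 ^ k) %/ 2 ^ i.
    by rewrite -mulnA -expnD subnK 1?ltnW // -divn_eq.
  rewrite divnMDl ?expn_gt0 // oddD oddM oddX /=.
  by rewrite orbF subn_eq0 leqNgt ik andbF.
rewrite divn_small // (leq_trans (ltn_pmod _ _)) ?expn_gt0 //.
by rewrite leq_exp2l.
Qed.

Lemma modn_exp2_id n : n %% 2 ^ n = n.
Proof. by rewrite modn_small // ltn_expl. Qed.

Lemma card_canonical_set_mod n k :
  #|` canonical_set (n %% 2 ^ k)| = \sum_(i < k) odd (n %/ 2 ^ i).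
Proof.
elim: k => [|k IH].
  rewrite big_ord0; apply/eqP; rewrite cardfs_eq0; apply/eqP/fsetP => i.
  by rewrite in_canonical_set_mod.
rewrite big_ord_recr /= -IH -in_canonical_set addnC.
have -> : canonical_set (n %% 2 ^ k.+1) =
    if k \in canonical_set n then (k |` canonical_set (n %% 2 ^ k))%fset
    else canonical_set (n %% 2 ^ k).
  case: ifP => kn; apply/fsetP => i.
    rewrite in_fset1U (in_canonical_set_mod n k.+1) (in_canonical_set_mod n k).
    rewrite ltnS leq_eqVlt.
    by case: eqP => // ->; rewrite kn.
  rewrite (in_canonical_set_mod n k.+1) (in_canonical_set_mod n k).
  rewrite ltnS leq_eqVlt.
  by case: eqP => // ->; rewrite kn !andbF.
case: ifP => // kn.
by rewrite cardfsU1 in_canonical_set_mod ltnn.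
Qed.

Lemma card_canonical_set n :
  #|` canonical_set n| = \sum_(i < n) odd (n %/ 2 ^ i).
Proof. by rewrite -[in LHS](modn_exp2_id n) card_canonical_set_mod. Qed.

Lemma exactly_largeP (s : {fset nat}) :
  reflect (exists m, [/\ m \in s, forall i, i \in s -> m <= i & #|` s| = m.+1])
    (exactly_large s).
Proof.
apply: (iffP hasP) => [[m ms /andP[/allP min /eqP card]]|[m [ms min card]]].
  by exists m.
by exists m => //; apply/andP; split; [apply/allP|rewrite card].
Qed.

Lemma canonical_set_exp2 i : canonical_set (2 ^ i) = [fset i]%fset.
Proof.
by rewrite -[RHS]canonical_indexK /canonical_index big_seq_fset1.
Qed.

(** An arithmetic test for largeness. With c the cardinality, the remainder modulo [2 ^ c] encodes
    the elements below c; it equals [2 ^ c.-1] exactly when c - 1 is the only one, hence the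
    minimum. The empty set fails, as its remainder is 0 and the right side is 1. *)
Lemma exactly_large_canonical n :
  exactly_large (canonical_set n) =
  (n %% 2 ^ #|` canonical_set n| == 2 ^ #|` canonical_set n|.-1).
Proof.
apply/exactly_largeP/eqP => [[m [ms min ->]]|].
  apply: canonical_set_inj; apply/fsetP => i.
  rewrite canonical_set_exp2 in_canonical_set_mod ltnS in_fset1 /=.
  apply/andP/eqP => [[im /min mi]|->]; last by rewrite ms.
  by apply/eqP; rewrite eqn_leq im.
case E: #|` canonical_set n| => [|m] /=.
  by rewrite modn1.
move/(congr1 canonical_set)/fsetP; rewrite canonical_set_exp2 => H.
exists m; split => // [|i ni].
  by have := H m; rewrite in_canonical_set_mod in_fset1 eqxx ltnSn.
rewrite leqNgt; apply/negP => im.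
have := H i; rewrite in_canonical_set_mod in_fset1 ni ltnS ltnW //=.
by rewrite ltn_eqF.
Qed.

(* The index of the large initial segment of [canonical_set n] below [k], and 0
   if there is none. *)
Definition bounded_large_prefix (n k : nat) : nat :=
  nat_rect (fun=> nat) 0 (fun i y =>
    if exactly_large (canonical_set (n %% 2 ^ i.+1)) then n %% 2 ^ i.+1 else y) k.

Definition large_prefix (n : nat) : nat := bounded_large_prefix n n.

(** A cut [k] above [n] may be replaced by [n], since [n < 2 ^ n] leaves both remainders equal to
    [n]. The search bounded by [n] thus reaches a large segment if there is one. *)
Lemma large_prefixP n k :
  exactly_large (canonical_set (n %% 2 ^ k)) ->
  exists2 j, large_prefix n = n %% 2 ^ j
    & exactly_large (canonical_set (n %% 2 ^ j)).
Proof.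
move=> Lk.
have {k Lk} [k kn Lk] : exists2 k, k <= n
    & exactly_large (canonical_set (n %% 2 ^ k)).
  case: (leqP k n) => kn; first by exists k.
  exists n => //; move: Lk; rewrite modn_exp2_id modn_small //.
  by apply: leq_trans (ltn_expl n (isT : 1 < 2)) _; rewrite leq_exp2l // ltnW.
suff H K : k <= K -> exists2 j, bounded_large_prefix n K = n %% 2 ^ j
    & exactly_large (canonical_set (n %% 2 ^ j)) by exact: H kn.
elim: K => [|K IH] kK.
  by exists k => //; move: kK; rewrite leqn0 => /eqP ->; rewrite expn0 modn1.
rewrite /=; case: ifP => LK; first by exists K.+1.
apply: IH; move: kK; rewrite leq_eqVlt => /orP[/eqP kK|//].
by rewrite -kK Lk in LK.
Qed.

(** The number of elements below [k] grows by at most one as [k] increases, so it is exactly [m.+1]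
    at the least [k] where it exceeds [m]. The cut there keeps some element, necessarily at least
    [m], and therefore keeps [m]. *)
Lemma exists_large_prefix n m :
  m \in canonical_set n -> (forall i, i \in canonical_set n -> m <= i) ->
  m < #|` canonical_set n| ->
  exists k, exactly_large (canonical_set (n %% 2 ^ k)).
Proof.
move=> mn min card.
have ex : exists k, m < #|` canonical_set (n %% 2 ^ k)|.
  by exists n; rewrite modn_exp2_id.
case: (ex_minnP ex) => k mk kmin.
have Ek : #|` canonical_set (n %% 2 ^ k)| = m.+1.
  apply/eqP; rewrite eqn_leq mk andbT.
  case: k mk kmin => [|k] mk kmin; first by rewrite card_canonical_set_mod big_ord0.
  have : #|` canonical_set (n %% 2 ^ k)| <= m.
    by rewrite leqNgt; apply/negP => /kmin; rewrite ltnn.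
  rewrite !card_canonical_set_mod big_ord_recr /= => le.
  by rewrite -[m.+1]addn1 leq_add // leq_b1.
exists k; apply/exactly_largeP; exists m; split => // [|i]; last first.
  by rewrite in_canonical_set_mod => /andP[_ /min].
rewrite in_canonical_set_mod mn andbT.
have : canonical_set (n %% 2 ^ k) != fset0 by rewrite -cardfs_eq0 Ek.
case/fset0Pn => i; rewrite in_canonical_set_mod => /andP[ik /min mi].
exact: leq_ltn_trans ik.
Qed.

Lemma canonical_index_fsetU1 z (t : {fset nat}) :
  z \notin t -> canonical_index (z |` t)%fset = 2 ^ z + canonical_index t.
Proof. by move=> zt; rewrite /canonical_index big_fsetU1. Qed.

Lemma canonical_index_mem z (t : {fset nat}) :
  z \in t -> 2 ^ z <= canonical_index t.
Proof. by move=> zt; rewrite /canonical_index (big_rem z zt) /= leq_addr. Qed.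

Lemma canonical_index_ub w (t : {fset nat}) :
  (forall i, i \in t -> i < w) -> canonical_index t < 2 ^ w.
Proof.
move=> tw; have -> : canonical_index t = canonical_index t %% 2 ^ w.
  apply: canonical_set_inj; apply/fsetP => i.
  rewrite in_canonical_set_mod canonical_indexK.
  by case: (boolP (i \in t)) => [/tw ->|]; rewrite ?andbF.
by rewrite ltn_pmod ?expn_gt0.
Qed.

(** The enlarged set has one element more than the large set [t], so it has a large initial segment.
    That segment omits [w], since otherwise it would be the whole enlarged set; hence its index is
    below [2 ^ w], which is at most the index of [t]. *)
Lemma large_prefix_fsetU1 (t : {fset nat}) z w :
  exactly_large t -> z \notin t -> w \in t -> (forall i, i \in t -> i <= w) ->
  z < w ->
  let r := large_prefix (canonical_index t + 2 ^ z) in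
  [/\ r < canonical_index t, exactly_large (canonical_set r)
    & {subset canonical_set r <= (z |` t)%fset}].
Proof.
move=> /exactly_largeP[m [mt min card]] zt wt max zw.
set n := _ + _.
have nE : canonical_set n = (z |` t)%fset.
  by rewrite /n addnC -canonical_index_fsetU1 // canonical_indexK.
have cardn : #|` canonical_set n| = m.+2 by rewrite nE cardfsU1 zt card.
(* The minimum of the enlarged set is [minn z m], as [z] may fall below [m]. *)
have ex : exists k, exactly_large (canonical_set (n %% 2 ^ k)).
  apply: (@exists_large_prefix _ (minn z m)).
  - by rewrite nE /minn !inE; case: ifP; rewrite ?eqxx ?mt ?orbT.
  - move=> i; rewrite nE !inE geq_min => /orP[/eqP ->|/min ->].
      by rewrite leqnn.
    by rewrite orbT.
  - by rewrite cardn ltnS (leq_trans (geq_minr _ _)).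
case: ex => k0 /large_prefixP[k /= -> Lk]; split => //; last first.
  by move=> i; rewrite in_canonical_set_mod nE => /andP[].
suff kw : k <= w.
  apply: leq_trans (ltn_pmod _ _) _; rewrite ?expn_gt0 //.
  apply: leq_trans (canonical_index_mem wt).
  by rewrite leq_exp2l.
rewrite leqNgt; apply/negP => wk.
have E : canonical_set (n %% 2 ^ k) = canonical_set n.
  apply/fsetP => i; rewrite in_canonical_set_mod.
  case: (boolP (i \in _)); rewrite ?andbF // nE !inE => /orP[/eqP ->|/max iw].
    by rewrite (ltn_trans zw).
  by rewrite (leq_ltn_trans iw).
(* The whole enlarged set has [m.+2] elements, so its minimum would be [m.+1], although it contains
   [m]. *)
move: Lk; rewrite E => /exactly_largeP[m' [_ min']].
rewrite cardn => -[mm'].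
by have := min' m; rewrite nE !inE mt orbT -mm' ltnn => /(_ isT).
Qed.

(** * The parity coloring and its descending orbits *)

(* [pullback] is the passage from t to s = (t \ {max t}) - 1, on indices. *)
Definition pullback (n : nat) : nat := (n %% 2 ^ trunc_log 2 n)./2.

(* The [minn] makes every orbit of [step] descend, also from indices outside
   [nat]^{!omega}. *)
Definition step (X : nat -> nat) (n : nat) : nat :=
  minn n (large_prefix (n + 2 ^ (X (pullback n)).+1)).

(* The parity of the number of proper descents; [n] steps are enough since each
   of them lowers the index. *)
Definition color (X : nat -> nat) (n : nat) : bool :=
  odd (\sum_(i < n) (iter i.+1 (step X) n < iter i (step X) n)).

(** An orbit that once fails to drop is constant from then on. A drop at time [k] is thus preceded
    by [k] drops of at least one each, and it starts from a positive value. *)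
Lemma iter_step_descent X k n :
  iter k.+1 (step X) n < iter k (step X) n -> k < n.
Proof.
move=> lt; suff : k + iter k (step X) n <= n.
  by apply: leq_trans; rewrite -addn1 leq_add2l (leq_ltn_trans _ lt).
elim: k lt => // k IH; rewrite 2!iterS.
have : iter k.+1 (step X) n <= iter k (step X) n by rewrite iterS geq_minl.
rewrite leq_eqVlt => /orP[/eqP E|lt _].
  by rewrite -iterS E -iterS E ltnn.
by apply: leq_trans (IH lt); rewrite addSnnS leq_add2l.
Qed.

(** The orbit of [n] is one drop followed by the orbit of [step X n], so the two counts differ by
    one. *)
Lemma color_step X n : step X n < n -> color X (step X n) = ~~ color X n.
Proof.
case: n => // n lt; rewrite /color big_ord_recl /= lt oddD /= negbK.
set m := step X n.+1 in lt *; congr odd.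
have -> : \sum_(i < n) (step X (iter (bump 0 i) (step X) n.+1) <
    iter (bump 0 i) (step X) n.+1)
  = \sum_(i < n) (iter i.+1 (step X) m < iter i (step X) m).
  by apply: eq_bigr => i _; rewrite /bump add1n iterSr.
(* The remaining sum has [n] terms, while the color of [m] counts only [m]; the surplus terms vanish
   because the orbit of [m] cannot drop at time [m] or later. *)
rewrite -(subnKC (lt : m <= n)) big_split_ord /= [X in _ = _ + X]big1 ?addn0 //.
move=> i _; case: ltnP => // /iter_step_descent.
by rewrite ltnNge leq_addr.
Qed.

(** * Computability of the coloring and its representation *)

Lemma computable_exactly_large k F :
  computable k F ->
  computable k (fun X v => exactly_large (canonical_set (F X v)) : nat).
Proof.
move=> HF.
have Hcard : computable k (fun X v => #|` canonical_set (F X v)|).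
  apply: computable_ext
    (computable_sum (S := fun _ i n => odd (n %/ 2 ^ i)) _ HF HF).
    by move=> X v _; rewrite card_canonical_set.
  by apply/computable_odd/computable_div_exp2; apply: computable_proj.
apply: computable_ext (computable_eq (computable_mod_exp2 HF Hcard)
  (computable_exp2 (computable_pred Hcard))).
by move=> X v _; rewrite exactly_large_canonical.
Qed.

Lemma computable_large_prefix k F :
  computable k F -> computable k (fun X v => large_prefix (F X v)).
Proof.
move=> HF.
have H : computable 2 (fun _ v => bounded_large_prefix (nth 0 v 1) (nth 0 v 0)).
  apply: (computable_rec2 (F := fun _ _ => 0) (G := fun _ n i y =>
    if exactly_large (canonical_set (n %% 2 ^ i.+1)) then n %% 2 ^ i.+1 else y)).
    exact: computable_const.
  have Hmod : computable 3 (fun _ v => nth 0 v 2 %% 2 ^ (nth 0 v 0).+1).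
    by apply: computable_mod_exp2; [|apply: computable_succ]; apply: computable_proj.
  apply: computable_if => //; last exact: computable_proj.
  exact: computable_exactly_large.
exact: (computable_comp2 H HF HF).
Qed.

Lemma computable_step k F :
  computable k F -> computable k (fun X v => step X (F X v)).
Proof.
move=> HF; apply: computable_minn => //; apply: computable_large_prefix.
apply: computable_add => //.
apply/computable_exp2/computable_succ/computable_oracle/computable_half.
exact/computable_mod_exp2/computable_trunc_log2.
Qed.

Lemma computable_color k F :
  computable k F -> computable k (fun X v => color X (F X v) : nat).
Proof.
move=> HF; apply: computable_odd.
apply: (computable_sum (S := fun X i n =>
  iter i.+1 (step X) n < iter i (step X) n)) => //.
have Hstep : computable 1 (fun X v => step X (nth 0 v 0)).
  exact/computable_step/computable_proj.
have H i : i < 2 -> computable 2 (fun _ v => nth 0 v i) by apply: computable_proj.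
apply: computable_leq; first apply: computable_succ.
  by apply: computable_iter; [|apply: computable_succ|]; auto.
by apply: computable_iter; auto.
Qed.

Lemma coloring_rep_index f (s : large_set) :
  coloring_rep f (canonical_index (val s)) = f s.
Proof. by rewrite /coloring_rep canonical_indexK valK. Qed.

Lemma coloring_rep_color X (f : large_set -> nat) :
  (forall s, f s = color X (canonical_index (val s))) ->
  forall n, coloring_rep f n =
    if exactly_large (canonical_set n) then color X n : nat else 0.
Proof.
move=> fE n; rewrite /coloring_rep; case: insubP => [s -> sE|/negbTE -> //].
by rewrite fE sE canonical_setK.
Qed.

(** * Shifting a large set and adding a new maximum *)

Definition successors (s : {fset nat}) : {fset nat} := [fset i.+1 | i in s]%fset.

Lemma in_successors s i : (i \in successors s) = (0 < i) && (i.-1 \in s).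
Proof.
apply/imfsetP/andP => [[j js ->] //|[i0 is_]].
by exists i.-1 => //; rewrite prednK.
Qed.

Lemma card_successors s : #|` successors s| = #|` s|.
Proof. by rewrite card_imfset //; apply: succn_inj. Qed.

(** This is why [pullback] undoes the shift by halving. *)
Lemma canonical_index_successors s :
  canonical_index (successors s) = (canonical_index s).*2.
Proof.
rewrite /canonical_index big_imfset /=; last by move=> i j _ _ [].
by rewrite -mul2n big_distrr /=; apply: eq_bigr => i _; rewrite expnS.
Qed.

(** The new maximum [w] is the leading binary digit, so the logarithm finds it and the remainder
    removes it. *)
Lemma pullback_top (s : {fset nat}) w :
  (forall i, i \in s -> i.+1 < w) ->
  pullback (canonical_index (w |` successors s)%fset) = canonical_index s.
Proof.
move=> sw.
have lt : canonical_index (successors s) < 2 ^ w.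
  apply: canonical_index_ub => i; rewrite in_successors => /andP[i0 /sw].
  by rewrite prednK.
rewrite canonical_index_fsetU1; last first.
  by apply/negP; rewrite in_successors => /andP[w0 /sw]; rewrite prednK // ltnn.
rewrite /pullback (@trunc_log_eq 2 w) //.
  by rewrite modnDl modn_small // canonical_index_successors doubleK.
by rewrite leq_addr expnS mul2n -addnn ltn_add2l.
Qed.

(** The shift raises the minimum by one, and [w] supplies the one extra element then required. *)
Lemma exactly_large_top (s : {fset nat}) w :
  exactly_large s -> (forall i, i \in s -> i.+1 < w) ->
  exactly_large (w |` successors s)%fset.
Proof.
move=> /exactly_largeP[m [ms min card]] sw; apply/exactly_largeP.
exists m.+1; split.
- by rewrite in_fset1U in_successors ms orbT.
- move=> i; rewrite in_fset1U => /orP[/eqP ->|]; first exact/ltnW/sw.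
  by rewrite in_successors => /andP[i0 /min]; rewrite -ltnS prednK.
- rewrite cardfsU1 card_successors card in_successors.
  by case: andP => // -[w0 /sw]; rewrite prednK // ltnn.
Qed.

(** * Infinite sets of naturals and the reduction *)

Lemma infinite_set_nat_gt (Y : set nat) n :
  infinite_set Y -> exists2 w, Y w & n < w.
Proof.
move=> infY; apply: contrapT => H; apply: infY.
apply: sub_finite_set (finite_II n.+1) => w Yw /=.
by rewrite ltnS leqNgt; apply/negP => nw; apply: H; exists w.
Qed.

Lemma infinite_set_preimage_succ (Y : set nat) :
  infinite_set Y -> infinite_set [set n | Y n.+1]%classic.
Proof.
move=> infY finH; apply: infY.
apply: sub_finite_set (_ : finite_set ([set 0] `|` S @` [set n | Y n.+1])%classic).
  by move=> [|n] Yn; [left|right; exists n].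
by rewrite finite_setU; split; [apply: finite_set1|apply: finite_image].
Qed.

Theorem theorem3p4 : FS_large <=sW RT2_large.
Proof.
(* [Phi] tests for largeness because the representation of a coloring is 0 at indices of all other
   sets. *)
have [Phi HPhi] : computable 1 (fun X v =>
    if exactly_large (canonical_set (nth 0 v 0)) then color X (nth 0 v 0) : nat
    else 0).
  have H : computable 1 (fun _ v => nth 0 v 0) by apply: computable_proj.
  apply: computable_if; [exact: computable_exactly_large| |exact: computable_const].
  exact: computable_color.
(* [Psi] reads only the homogeneous set, as strong reducibility demands. *)
have [Psi HPsi] : computable 1 (fun X v => X (nth 0 v 0).+1).
  exact/computable_oracle/computable_succ/computable_proj.
exists Phi, Psi => f; pose X := coloring_rep f.
pose p (s : large_set) : 'I_2 := inord (color X (canonical_index (val s))).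
have pE s : p s = color X (canonical_index (val s)) :> nat.
  by rewrite inordK // ltnS leq_b1.
exists p => /=.
  by move=> n; rewrite (coloring_rep_color pE); apply: HPhi.
move=> Y [infY [c pY]]; exists [set n | Y n.+1]%classic.
  move=> n.
  have -> : set_rep [set n | Y n.+1]%classic n = set_rep Y n.+1 by [].
  exact: (HPsi (set_rep Y) [:: n]).
split; first exact: infinite_set_preimage_succ.
move=> s sH [/= Yz zs].
have homog r : exactly_large (canonical_set r) ->
    (forall i, i \in canonical_set r -> Y i) -> color X r = c :> nat.
  move=> Lr rY; pose t : large_set := Sub (canonical_set r) Lr.
  have <- : p t = c.
    by have : (p @` large_subsets Y)%classic (p t); [exists t|rewrite pY].
  by rewrite pE canonical_setK.
(* Taking successors under the maximum puts [w] above [(f s).+1] and above the whole shifted copy of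
   [s]. *)
have [w Yw] := infinite_set_nat_gt (\max_(i <- f s :: val s) i.+1) infY.
rewrite big_cons gtn_max => /andP[zw sw].
have {}sw i : i \in val s -> i.+1 < w.
  by move=> si; apply: leq_ltn_trans sw; rewrite (big_rem i si) leq_maxl.
set t := (w |` successors (val s))%fset.
have Lt : exactly_large t by apply: exactly_large_top => //; apply: valP.
have tY i : i \in t -> Y i.
  rewrite in_fset1U => /orP[/eqP -> //|]; rewrite in_successors.
  by case: i => // i /=; apply: sH.
have zt : (f s).+1 \notin t.
  rewrite in_fset1U in_successors negb_or /= ltn_eqF //=.
  by apply/negP.
have tw i : i \in t -> i <= w.
  rewrite in_fset1U => /orP[/eqP -> //|]; rewrite in_successors.
  by case: i => // i /= /sw/ltnW.
have [lt Lr rY] := large_prefix_fsetU1 Lt zt (fset1U1 _ _) tw zw.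
(* Since [pullback] returns the index of [s], the oracle answers [f s]; the [minn] selects the
   prefix because its index is smaller. *)
have stepE : step X (canonical_index t) =
    large_prefix (canonical_index t + 2 ^ (f s).+1).
  rewrite /step pullback_top // /X coloring_rep_index.
  exact/minn_idPr/ltnW.
(* Both sets are large subsets of [Y], so homogeneity equates their colors, against [color_step]. *)
have : color X (canonical_index t) = color X (step X (canonical_index t)) :> nat.
  rewrite !homog ?canonical_indexK ?stepE // => i /rY.
  by rewrite in_fset1U => /orP[/eqP ->|/tY].
by rewrite color_step ?stepE //; case: color.
Qed.
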